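(* Let $T$ be a tree (all of whose vertices have finite degree) with color classes $B \neq \emptyset$ and $W$, let $n$ be a positive integer, let $h: B^n \to \mathbf{R}\cup\{\infty\}$ be an L-extendable function, and let $g: T^n \to \mathbf{R}\cup\{\infty\}$ be an L-convex relaxation of $h$. For every minimizer $x$ of $g$ (over $T^n$), there is a minimizer $y$ of $h$ (over $B^n$) with $y \in \mathcal{F}(x) \cap B^n$.
   Context: The vertex set of a tree $T$ is also denoted by $T$, and $d$ denotes its path metric. $T$ is regarded as a bipartite graph with color classes $B$ (black) and $W$ (white). Define a partial order on $T$ by: $u \prec v$ iff $u,v$ are adjacent with $u \in W$, $v \in B$. $T^n$ carries the product order $\preceq$, and $\mathcal{F}(x) := \{y \in T^n \mid y \succeq x\}$ for $x\in T^n$. For $u,v \in T$ there is a unique pair $(a,b)$ of vertices with $d(u,v) = d(u,a)+d(a,b)+d(b,v)$, $d(u,a)=d(b,v)$ and $d(a,b) \le 1$. Define $u \bullet v$ and $u \circ v$ by $\{u\bullet v, u \circ v\} = \{a,b\}$ and $u \circ v \preceq u \bullet v$. On $T^n$ the operations are componentwise. A function $g: T^n \to \mathbf{R}\cup\{\infty\}$ is (alternating) L-convex if $g(x)+g(y) \ge g(x \bullet y) + g(x \circ y)$ for all $x,y \in T^n$. A function $h: B^n \to \mathbf{R}\cup\{\infty\}$ is L-extendable if there is an L-convex function $g$ on $T^n$ whose restriction to $B^n$ equals $h$; any such $g$ is called an L-convex relaxation of $h$. *)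

(* Defs.v *)
From HB Require Import structures.
From mathcomp Require Import all_boot all_order all_algebra.
From mathcomp Require Import boolp classical_sets reals constructive_ereal.

Set Implicit Arguments.
Unset Strict Implicit.
Unset Printing Implicit Defensive.

Import Order.TTheory GRing.Theory Num.Theory.

Local Open Scope nat_scope.
Local Open Scope classical_set_scope.

(* A graph is a vertex type [T], possibly infinite, with an adjacency relation
   [e].  Distances are made total with [xget]; the default value is only
   reached between disconnected vertices. *)
Section Tree.
Variables (T : choiceType) (e : rel T).

Record is_tree : Prop := IsTree {
  tree_sym : symmetric e;
  tree_irrefl : irreflexive e;
  tree_connected : forall u v, exists2 p, path e u p & last u p = v;
  tree_acyclic : forall c : seq T, 2 < size c -> ~ ucycle e c
}.

Definition locally_finite : Prop :=
  forall u, exists s : seq T, forall v, e u v -> v \in s.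

Definition walk_lengths (u v : T) : set nat :=
  [set k | exists p, [/\ path e u p, last u p = v & size p = k]].

Definition dist (u v : T) : nat :=
  xget 0 [set k | walk_lengths u v k /\
                  forall m, walk_lengths u v m -> k <= m].

Definition is_midpair (u v : T) (ab : T * T) : Prop :=
  [/\ dist u v = dist u ab.1 + dist ab.1 ab.2 + dist ab.2 v,
      dist u ab.1 = dist ab.2 v
    & dist ab.1 ab.2 <= 1].

(* In a tree exactly one pair satisfies [is_midpair u v], so the default
   [(u, v)] of [xget] plays no role. *)
Definition midpair (u v : T) : T * T := xget (u, v) [set ab | is_midpair u v ab].

End Tree.

(* [B] is the set of black vertices; the white ones are its complement. *)
Section Bipartite.
Variables (T : choiceType) (e : rel T) (B : {pred T}).

Definition color_class : Prop :=
  forall u v, e u v -> (u \in B) != (v \in B).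

Definition vlt (u v : T) : bool := [&& e u v, u \notin B & v \in B].
Definition vle (u v : T) : bool := (u == v) || vlt u v.

(* The two entries of [midpair u v] are equal or adjacent, hence comparable:
   [vbullet] is the larger and [vcirc] the smaller. *)
Definition vbullet (u v : T) : T :=
  let: (a, b) := midpair e u v in if vle a b then b else a.
Definition vcirc (u v : T) : T :=
  let: (a, b) := midpair e u v in if vle a b then a else b.

Section Power.
Variable n : nat.
Implicit Types x y : {ffun 'I_n -> T}.

Definition ple x y : Prop := forall i, vle (x i) (y i).
Definition pfilter x : set {ffun 'I_n -> T} := [set y | ple x y].

Definition pbullet x y : {ffun 'I_n -> T} := [ffun i => vbullet (x i) (y i)].
Definition pcirc x y : {ffun 'I_n -> T} := [ffun i => vcirc (x i) (y i)].

Definition black_pow : Type := {ffun 'I_n -> {u : T | u \in B}}.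
Definition black_incl (y : black_pow) : {ffun 'I_n -> T} :=
  [ffun i => sval (y i)].

End Power.
End Bipartite.

(* Functions into R \cup {oo} are functions into [\bar R] avoiding [-oo]. *)
Definition no_minfty (R : realType) (X : Type) (f : X -> \bar R) : Prop :=
  forall x, f x <> -oo%E.

Definition minimizer (R : realType) (X : Type) (f : X -> \bar R) (x : X) : Prop :=
  forall y, (f x <= f y)%E.

Section LConvex.
Variables (R : realType) (T : choiceType) (e : rel T) (B : {pred T}) (n : nat).

Definition L_convex (g : {ffun 'I_n -> T} -> \bar R) : Prop :=
  no_minfty g /\
  forall x y, (g (pbullet e B x y) + g (pcirc e B x y) <= g x + g y)%E.

Definition L_convex_relaxation (h : black_pow B n -> \bar R)
    (g : {ffun 'I_n -> T} -> \bar R) : Prop :=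
  L_convex g /\ forall y : black_pow B n, g (black_incl y) = h y.

Definition L_extendable (h : black_pow B n -> \bar R) : Prop :=
  no_minfty h /\ exists g, L_convex_relaxation h g.

End LConvex.

(* Main.v *)
(* For z in B^n, L-convexity at (z, x) together with g x <= g (z o x) gives
   g (z * x) <= g z, where * is the upper and o the lower midpoint.  Iterating
   z |-> z * x decreases the distance to x in each coordinate as long as it
   exceeds 1.  A coordinate with x_i white stays black, because z_i and x_i are
   then at odd distance and the upper of the two middle vertices is black; a
   coordinate with x_i black may turn white on the way but ends at x_i.  So the
   iteration ends in F(x) and B^n without increasing g, and h attains its
   minimum on the finite set of points of F(x) in B^n. *)
Require Import Defs.
From HB Require Import structures.
From mathcomp Require Import all_boot all_order all_algebra.
From mathcomp Require Import boolp classical_sets reals constructive_ereal.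
From mathcomp Require Import zify.

Set Implicit Arguments.
Unset Strict Implicit.
Unset Printing Implicit Defensive.

Import Order.TTheory.

Local Open Scope nat_scope.

Section Distance.
Variables (T : choiceType) (e : rel T).
Hypothesis hT : is_tree e.

Lemma dist_walkP u v : walk_lengths e u v (dist e u v) /\
  forall m, walk_lengths e u v m -> dist e u v <= m.
Proof.
have ex : exists k, `[< walk_lengths e u v k >].
  have [p pp pl] := tree_connected hT u v.
  by exists (size p); apply/asboolP; exists p.
case: (ex_minnP ex) => k /asboolP wk mink.
rewrite /dist; apply: (@xgetPex _ 0 [set k | walk_lengths e u v k /\
  forall m, walk_lengths e u v m -> k <= m]).
by exists k; split=> // m wm; apply/mink/asboolP.
Qed.

Lemma dist_geodesic u v :
  exists p, [/\ path e u p, last u p = v & size p = dist e u v].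
Proof. exact: (dist_walkP u v).1. Qed.

Lemma dist_last u p : path e u p -> dist e u (last u p) <= size p.
Proof. by move=> pp; apply: (dist_walkP _ _).2; exists p. Qed.

Lemma dist_triangle u v w : dist e u w <= dist e u v + dist e v w.
Proof.
have [p [pp <- <-]] := dist_geodesic u v.
have [q [pq <- <-]] := dist_geodesic (last u p) w.
by rewrite -last_cat -size_cat dist_last // cat_path pp.
Qed.

Lemma dist_eq0 u v : dist e u v = 0 -> u = v.
Proof. by have [[|y p] [_ /= <- <-]] := dist_geodesic u v. Qed.

Lemma dist_eq1 u v : dist e u v = 1 -> e u v.
Proof.
by have [[|y [|z p]] [/= + <- <-]] := dist_geodesic u v => // /andP[].
Qed.

(** A geodesic of length [d] is cut into pieces of lengths [d./2], [odd d], [d./2]; the triangle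
    inequality forces each piece to realize the distance between its ends. *)
Lemma midpairP u v : is_midpair e u v (midpair e u v).
Proof.
apply: (@xgetPex _ (u, v) [set ab | is_midpair e u v ab]).
have [p [pp pl ps]] := dist_geodesic u v.
set d := dist e u v in ps *; pose k := d./2.
pose q := drop k p.
have dE := odd_double_half d.
have sq : size q = d - k by rewrite size_drop ps.
have pE : p = take k p ++ take (odd d) q ++ drop (odd d) q.
  by rewrite !cat_take_drop.
move: pp pl; rewrite pE !cat_path !last_cat => /and3P[].
set a := last u _ => /dist_last; rewrite -/a => da.
set b := last a _ => /dist_last; rewrite -/b => dab.
move=> /dist_last + bv; rewrite bv => db.
have da' : dist e u a <= k.
  by apply: leq_trans da _; rewrite size_take_min geq_minl.
have dab' : dist e a b <= odd d.
  by apply: leq_trans dab _; rewrite size_take_min geq_minl.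
have db' : dist e b v <= k.
  by apply: leq_trans db _; rewrite size_drop sq; lia.
have t1 := dist_triangle u a v; have t2 := dist_triangle a b v.
have dE' : dist e u v = k + (odd d + k) by rewrite -/d; lia.
by exists (a, b); split => /=; move: da' dab' db' t1 t2 dE'; case: odd; lia.
Qed.

Variable B : {pred T}.
Hypothesis hcol : color_class e B.

Lemma path_color u p : path e u p ->
  (last u p \in B) = (u \in B) (+) odd (size p).
Proof.
elim: p u => [|v p IH] u /=; first by rewrite addbF.
move=> /andP[/hcol uv /IH ->].
by case: (u \in B) (v \in B) uv => -[]; case: odd.
Qed.

Lemma odd_dist u v : odd (dist e u v) = (u \in B) (+) (v \in B).
Proof.
have [p [pp <- <-]] := dist_geodesic u v.
by rewrite (path_color pp) addbA addbb.
Qed.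

Lemma vbullet_color z x : (x \in B) || (z \in B) ->
  (x \in B) || (vbullet e B z x \in B).
Proof.
case: (boolP (x \in B)) => //= xW zB.
have := odd_dist z x; rewrite zB (negbTE xW) /= /vbullet.
case: (midpair e z x) (midpairP z x) => a b [/= -> -> d1] od.
(* The two outer distances agree, so [dist e a b] has the parity of the whole distance, which is
   odd. *)
have /dist_eq1 ab : dist e a b = 1 by lia.
have ne := hcol ab; rewrite /vle /vlt ab.
case: eqP => [E|_] /=; first by rewrite E eqxx in ne.
by case: (boolP (a \in B)) ne => [aB|_] /=;
  [rewrite aB | case: (boolP (b \in B))].
Qed.

(** At distance at most 1 the midpair is [(z, x)] itself, so the upper midpoint is whichever of the
    two is black. *)
Lemma vbullet_near z x : (x \in B) || (z \in B) -> dist e z x <= 1 ->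
  vle e B x (vbullet e B z x) && (vbullet e B z x \in B).
Proof.
move=> zB; rewrite /vbullet.
case: (midpair e z x) (midpairP z x) => a b [/= dE E d1] d2.
have /dist_eq0 za : dist e z a = 0 by lia.
have /dist_eq0 bx : dist e b x = 0 by lia.
subst a b.
case: (posnP (dist e z x)) => [/dist_eq0 zx|d0].
  by subst z; rewrite /vle eqxx /= eqxx; move: zB; rewrite orbb.
have /dist_eq1 ezx : dist e z x = 1 by lia.
have exz : e x z by rewrite (tree_sym hT).
have := hcol ezx; case: (boolP (x \in B)) zB => /= [xB _|xW zB].
  case: (boolP (z \in B)) => // zW _.
  by rewrite [vle e B z x]/vle /vlt ezx zW xB orbT /vle eqxx.
have zx : vle e B z x = false.
  by rewrite /vle /vlt zB andbF orbF; apply: contraNF xW => /eqP <-.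
by rewrite zx /vle /vlt exz xW zB orbT.
Qed.

(** Beyond distance 1 the first middle vertex differs from [z], so both middle vertices are strictly
    nearer to [x]. At distance 1 the upper one may be [z] itself. *)
Lemma vbullet_closer z x : 1 < dist e z x ->
  dist e (vbullet e B z x) x < dist e z x.
Proof.
rewrite /vbullet.
case: (midpair e z x) (midpairP z x) => a b [/= dE E d1] d2.
have := dist_triangle a b x.
by case: ifP => _; lia.
Qed.

Lemma vle_dist x z : vle e B x z -> dist e z x <= 1.
Proof.
rewrite /vle /vlt => /orP[/eqP <-|/and3P[xz _ _]].
  by apply: leq_trans (dist_last (p := [::]) isT) _.
have zx : path e z [:: x] by rewrite /= (tree_sym hT) xz.
exact: dist_last zx.
Qed.

(** Only an upper bound on the distance is asked, so that one number of steps serves all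
    coordinates, whatever their distances. *)
Lemma iter_vbullet z x k : (x \in B) || (z \in B) -> dist e z x <= k.+1 ->
  let w := iter k.+1 (fun w => vbullet e B w x) z in
  vle e B x w && (w \in B).
Proof.
elim: k z => [|k IH] z zB dk; first exact: vbullet_near.
rewrite iterSr; apply: IH; first exact: vbullet_color.
(* Once within distance 1, the next iterate lies above [x] and is again within distance 1, so
   surplus steps do no harm. *)
have [d1|/vbullet_closer] := leqP (dist e z x) 1; last lia.
by have /andP[/vle_dist /leq_trans->] := vbullet_near zB d1.
Qed.

End Distance.

Lemma pbullet_le_minimizer (R : realType) (T : choiceType) (e : rel T)
    (B : {pred T}) (n : nat) (g : {ffun 'I_n -> T} -> \bar R) x z :
  L_convex e B g -> minimizer g x -> (g (pbullet e B z x) <= g z)%E.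
Proof.
move=> [gN gC] gx; have := gC z x; have := gx (pcirc e B z x).
have := gN x; have := gx z.
(* Cancelling [g x] requires it to be finite; if it is infinite, so is [g z], by minimality of
   [x]. *)
case: (g x) => [r| |] // zx _ cx.
  move=> /(le_trans (leeD2l _ cx)).
  by rewrite leeD2rE.
by move: zx; rewrite leye_eq => /eqP -> _; rewrite leey.
Qed.

Section BlackFilter.
Variables (T : choiceType) (e : rel T) (B : {pred T}) (n : nat).
Hypotheses (hT : is_tree e) (hfin : locally_finite e).

(** Each coordinate of a point above [x] is [x i] or one of its finitely many neighbours. *)
Lemma black_filter_finite (x : {ffun 'I_n -> T}) :
  exists (K : finType) (c : K -> black_pow B n),
    forall y : black_pow B n, pfilter e B x (black_incl y) -> exists k, c k = y.
Proof.
have [s sP] := choice hfin.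
pose S : seq {u : T | u \in B} :=
  pmap insub (flatten [seq x i :: s (x i) | i <- enum 'I_n]).
exists {ffun 'I_n -> seq_sub S},
  (fun k : {ffun 'I_n -> seq_sub S} => [ffun i => val (k i)]) => y xy.
have yS i : y i \in S.
  rewrite mem_pmap_sub; apply/flattenP; exists (x i :: s (x i)).
    by apply: map_f; rewrite mem_enum.
  have := xy i; rewrite ffunE => /orP[/eqP ->|/and3P[/sP xs _ _]].
    exact: mem_head.
  by rewrite inE xs orbT.
by exists [ffun i => SeqSub (yS i)]; apply/ffunP => i; rewrite !ffunE.
Qed.

Lemma black_filter_min d (V : orderType d) (h : black_pow B n -> V) x
    (y0 : black_pow B n) :
  pfilter e B x (black_incl y0) ->
  exists2 y : black_pow B n, pfilter e B x (black_incl y) &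
    forall w : black_pow B n, pfilter e B x (black_incl w) -> (h y <= h w)%O.
Proof.
have [K [c cP]] := black_filter_finite x.
move=> y0x; have [k0 k0E] := cP _ y0x.
have Pk0 : `[< pfilter e B x (black_incl (c k0)) >].
  by apply/asboolP; rewrite k0E.
(* The image of [c] may leave the filter, so the minimum is taken only over indices [k] with [c k]
   in it; [k0] is one. *)
case: (@arg_minP _ _ _ k0 (fun k => `[< pfilter e B x (black_incl (c k)) >])
  (h \o c) Pk0) => k /asboolP kx kmin.
exists (c k) => // w wx; have [l lE] := cP _ wx.
by rewrite -lE; apply: kmin; apply/asboolP; rewrite lE.
Qed.

Hypothesis hcol : color_class e B.

Lemma black_descent (R : realType) (g : {ffun 'I_n -> T} -> \bar R) x
    (z : black_pow B n) :
  L_convex e B g -> minimizer g x ->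
  exists2 w : black_pow B n,
    pfilter e B x (black_incl w) & (g (black_incl w) <= g (black_incl z))%E.
Proof.
move=> gC gx; pose f w := pbullet e B w x.
(* The largest coordinate distance: [N.+1] steps then suffice in every coordinate at once. *)
pose N := \max_i dist e (black_incl z i) (x i).
pose w := iter N.+1 f (black_incl z).
have wE i : w i = iter N.+1 (fun v => vbullet e B v (x i)) (black_incl z i).
  by rewrite /w; elim: N.+1 => //= k <-; rewrite ffunE.
have wP i : vle e B (x i) (w i) && (w i \in B).
  rewrite wE; apply: iter_vbullet => //.
    by rewrite ffunE (valP (z i)) orbT.
  by apply/leqW/(leq_bigmax i).
(* Intermediate iterates may have white coordinates, so the iteration runs in [T^n] and only its
   last point is turned into an element of [black_pow]. *)
have wB i : w i \in B by have /andP[] := wP i.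
have E : black_incl [ffun i => exist _ (w i) (wB i)] = w.
  by apply/ffunP => i; rewrite !ffunE.
exists [ffun i => exist _ (w i) (wB i)]; rewrite E.
  by move=> i; have /andP[] := wP i.
rewrite /w; elim: N.+1 => //= k; apply: le_trans.
exact: pbullet_le_minimizer.
Qed.

End BlackFilter.

Theorem theorem2p10 (R : realType) (T : choiceType) (e : rel T) (B : {pred T})
    (n : nat) (h : black_pow B n -> \bar R)
    (g : {ffun 'I_n -> T} -> \bar R)
    (hT : is_tree e) (hfin : locally_finite e)
    (hcol : color_class e B) (hB : exists b : T, b \in B)
    (hn : (0 < n)%N)
    (hh : L_extendable e h) (hg : L_convex_relaxation e h g) :
  forall x : {ffun 'I_n -> T}, minimizer g x ->
    exists y : black_pow B n, pfilter e B x (black_incl y) /\ minimizer h y.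
Proof.
move=> x gx; have [gC gh] := hg; have [b bB] := hB.
(* Descent from an arbitrary constant black point shows that the filter of [x] meets [B^n]. *)
have [y0 y0x _] := black_descent hT hcol [ffun=> exist _ b bB] gC gx.
have [y yx ymin] := black_filter_min hfin h y0x.
exists y; split=> // z.
have [w wx wz] := black_descent hT hcol z gC gx.
by apply: le_trans (ymin w wx) _; rewrite -!gh.
Qed.
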